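(* Let $S$ be a symmetric operator on a Hilbert space $H$ with finite and equal defect indices $\eta := \dim\ker(S^*-\mathrm{i}) = \dim\ker(S^*+\mathrm{i}) < \infty$, let $(\Gamma_0,\Gamma_1,\mathbb{C}^\eta)$ be a boundary triple for $S^*$, and let $V\ge0$ be a bounded operator on $H$. Let $B,C$ be invertible complex $\eta\times\eta$ matrices, let $\mathcal{U}\subseteq\mathcal{D}(S^* )$ be an $\eta$-dimensional subspace with $\mathcal{U}\cap\mathcal{D}(S)=\{0\}$ and $$\mathcal{D}(S)\dot+\,\mathcal{U}=\{f\in\mathcal{D}(S^* ): B\Gamma_0f=C\Gamma_1f\},$$ and let $\mathcal{L}:\mathcal{U}\to\operatorname{rg}(V^{1/2})$ be linear. Let $u_1,\dots,u_\eta\in\mathcal{U}$ be such that $\Gamma_1u_j=\vec e_j$ for $j=1,\dots,\eta$, where $\vec e_j$ is the $j$-th standard unit vector of $\mathbb{C}^\eta$. Then the dissipativity condition $$\operatorname{Im}\langle w,S^*w\rangle\ge\frac14\|V^{-1/2}\mathcal{L}w\|^2\qquad\text{for all } w\in\mathcal{U}$$ is equivalent to $$\operatorname{Im}(C^*B^{*-1})\ \ge\ \frac14\Big(\langle V^{-1/2}\mathcal{L}u_r,\,V^{-1/2}\mathcal{L}u_s\rangle\Big)_{r,s=1}^{\eta}.$$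
   Context: Hilbert spaces are complex; inner products are linear in the second and antilinear in the first argument. Symmetric operators are densely defined. $\mathcal{D}$ denotes domain, $\operatorname{rg}$ range. Boundary triple: $(\Gamma_0,\Gamma_1,\mathbb{C}^\eta)$ is a boundary triple for $S^*$ if $\Gamma_0,\Gamma_1:\mathcal{D}(S^* )\to\mathbb{C}^\eta$ are linear, $(\Gamma_0,\Gamma_1):\mathcal{D}(S^* )\to\mathbb{C}^\eta\oplus\mathbb{C}^\eta$ is surjective, Green's identity $\langle f,S^*g\rangle-\langle S^*f,g\rangle=\langle\Gamma_0f,\Gamma_1g\rangle-\langle\Gamma_1f,\Gamma_0g\rangle$ holds for all $f,g\in\mathcal{D}(S^* )$, and $\mathcal{D}(S)=\ker\Gamma_0\cap\ker\Gamma_1$. $V^{1/2}$ is the non-negative square root of $V$, and $V^{-1/2}:\operatorname{rg}(V^{1/2})\to(\ker V)^\perp$ is the inverse of $V^{1/2}$ restricted to $(\ker V)^\perp$. For a square matrix $M$, $\operatorname{Im}M:=\frac1{2\mathrm{i}}(M-M^* )$; inequalities between Hermitian matrices are in the sense of quadratic forms. Since $B$ is invertible, $\Gamma_1|_{\mathcal{U}}$ is a bijection onto $\mathbb{C}^\eta$, so the $u_j$ exist and are unique. (The condition is the criterion for the extension $\widehat A f=(S^*+\mathrm{i}V)f+\mathcal{L}Pf$, $\mathcal{D}(\widehat A)=\mathcal{D}(S)\dot+\mathcal{U}$, with $P$ the projection of $\mathcal{D}(\widehat A)$ onto $\mathcal{U}$ along $\mathcal{D}(S)$, of $S+\mathrm{i}V$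 to be dissipative.) *)

(* Defs.v *)
From HB Require Import structures.
From mathcomp Require Export all_boot all_order all_algebra complex.
From mathcomp Require Export all_classical all_reals all_analysis.
Export Order.TTheory GRing.Theory Num.Theory numFieldNormedType.Exports.

Set Implicit Arguments.
Unset Strict Implicit.
Unset Printing Implicit Defensive.

Local Open Scope classical_set_scope.
Local Open Scope ring_scope.

Section Matrices.
Variable K : numClosedFieldType.

Definition adjmx m n (A : 'M[K]_(m, n)) : 'M[K]_(n, m) := map_mx Num.conj A^T.

Definition cvdot n (x y : 'cV[K]_n) : K := (adjmx x *m y) ord0 ord0.

Definition mxIm n (M : 'M[K]_n) : 'M[K]_n := (2%:R * 'i)^-1 *: (M - adjmx M).

(* In a numClosedFieldType, x <= y implies that y - x is real. *)
Definition form_le n (M N : 'M[K]_n) : Prop :=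
  forall x : 'cV[K]_n, cvdot x (M *m x) <= cvdot x (N *m x).

End Matrices.

Section LinearAlgebra.
Variables (K : numFieldType) (E F : lmodType K).

Definition subspace (W : set E) : Prop :=
  W 0 /\ forall (a : K) x y, W x -> W y -> W (a *: x + y).

Definition linear_on (W : set E) (f : E -> F) : Prop :=
  forall (a : K) x y, W x -> W y -> f (a *: x + y) = a *: f x + f y.

(* W is a linear subspace with a basis of n vectors *)
Definition has_dim (W : set E) (n : nat) : Prop :=
  exists b : 'I_n -> E,
    (forall c : 'I_n -> K, \sum_i c i *: b i = 0 -> forall i, c i = 0) /\
    W = [set \sum_i c i *: b i | c in [set: 'I_n -> K]].

End LinearAlgebra.

(* A complex Hilbert space is a complete normed R[i]-module H with a positive
   definite Hermitian form dot inducing its norm.  MathComp forms are linear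
   in the first argument; inner products here are linear in the second. *)
Section Hilbert.
Variables (R : realType) (H : completeNormedModType R[i]).

Definition induces_norm (dot : {dot H for Num.conj}) : Prop :=
  forall f : H, `|f| ^+ 2 = dot f f.

Definition inner (dot : {dot H for Num.conj}) (f g : H) : R[i] := dot g f.

(* An unbounded operator; the values of [op_fun] outside [op_dom] are
   irrelevant. *)
Record operator := Operator { op_dom : set H; op_fun :> H -> H }.

Variable dot : {dot H for Num.conj}.
Local Notation "<< f , g >>" := (inner dot f g).

Definition is_adjoint_value (T : operator) (g h : H) : Prop :=
  forall f, op_dom T f -> << g, T f >> = << h, f >>.

(* For densely defined T the vector h below is unique. *)
Definition adjoint (T : operator) : operator :=
  Operator [set g | exists h, is_adjoint_value T g h]
           (fun g => xget 0 [set h | is_adjoint_value T g h]).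

Definition symmetric_operator (S : operator) : Prop :=
  [/\ subspace (op_dom S), linear_on (op_dom S) S, dense (op_dom S) &
      forall f g, op_dom S f -> op_dom S g -> << f, S g >> = << S f, g >>].

(* ker (T - z) *)
Definition eigenspace_op (T : operator) (z : R[i]) : set H :=
  [set f | op_dom T f /\ T f = z *: f].

Definition defect_indices_eq (S : operator) (eta : nat) : Prop :=
  has_dim (eigenspace_op (adjoint S) 'i) eta /\
  has_dim (eigenspace_op (adjoint S) (- 'i)) eta.

Definition boundary_triple (S : operator) (eta : nat)
    (G0 G1 : H -> 'cV[R[i]]_eta) : Prop :=
  let D := op_dom (adjoint S) in
  [/\ linear_on D G0 /\ linear_on D G1,
      forall x y, exists f, [/\ D f, G0 f = x & G1 f = y],
      forall f g, D f -> D g ->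
        << f, adjoint S g >> - << adjoint S f, g >> =
        cvdot (G0 f) (G1 g) - cvdot (G1 f) (G0 g) &
      op_dom S = [set f | [/\ D f, G0 f = 0 & G1 f = 0]]].

Definition bounded_operator (V : H -> H) : Prop :=
  linear V /\ exists M : R[i], forall x, `|V x| <= M * `|x|.

(* As R[i] is partially ordered, this forces << x, V x >> to be real. *)
Definition nonneg_operator (V : H -> H) : Prop := forall x, 0 <= << x, V x >>.

(* The non-negative bounded square root of V exists and is unique whenever V
   is bounded and non-negative; the default value V of [xget] is then unused. *)
Definition op_sqrt (V : H -> H) : H -> H :=
  xget V [set Q | [/\ bounded_operator Q, nonneg_operator Q &
                      forall x, Q (Q x) = V x]].

Definition ker_perp (V : H -> H) : set H :=
  [set x | forall k, V k = 0 -> << k, x >> = 0].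

(* V^(-1/2) : rg V^(1/2) -> (ker V)^perp; irrelevant outside rg V^(1/2) *)
Definition op_invsqrt (V : H -> H) (y : H) : H :=
  xget 0 [set x | ker_perp V x /\ op_sqrt V x = y].

End Hilbert.

(* Main.v *)
(* Green's identity with f = g = w, together with G0 w = B^-1 C G1 w on U, gives
   Im <w, S^* w> = <G1 w, Im (C^* B^*-1) G1 w>.  Since U meets D(S) trivially,
   w is the combination of the u_j with coefficient vector G1 w; hence
   |V^-1/2 L w|^2 is the Gram form of the vectors V^-1/2 L u_j evaluated at
   G1 w, and G1 maps U onto C^eta.  This uses that V^-1/2 is well defined and
   linear on rg V^1/2, which rests on ker V^1/2 = ker V and on the orthogonal
   projection onto the closed subspace ker V. *)

Require Import Defs.
From mathcomp Require Import ring.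

Set Implicit Arguments.
Unset Strict Implicit.
Unset Printing Implicit Defensive.

Local Open Scope classical_set_scope.
Local Open Scope ring_scope.

(** * Inner products: Cauchy-Schwarz and polarization *)

Section InnerProduct.
Variables (K : numClosedFieldType) (E : lmodType K) (dot : {dot E for Num.conj}).

Lemma dotC x y : dot x y = (dot y x)^*.
Proof. by rewrite hermC mul1r. Qed.

(** Pythagoras: the subtracted vector is the orthogonal projection of [x] onto the line through
    [y]. *)
Lemma dnorm_sub_proj x y : y != 0 ->
  dot (x - (dot x y / dot y y) *: y) (x - (dot x y / dot y y) *: y) =
  dot x x - `|dot x y| ^+ 2 / dot y y.
Proof.
move=> y0; have yy0 : dot y y != 0 by rewrite dnorm_eq0.
rewrite dnormB dnormZ linearZr_LR /= normrM normfV (ger0_norm (dnorm_ge0 _ _)).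
set c := dot x y; set q := dot y y in yy0 *.
have qr : q^* = q by apply/CrealP/ger0_real/dnorm_ge0.
have -> : (c / q)^* * c = `|c| ^+ 2 / q.
  by rewrite rmorphM fmorphV /= qr mulrAC -normCKC.
rewrite rmorphM fmorphV /= qr.
have -> : (`|c| ^+ 2)^* = `|c| ^+ 2 by apply/CrealP/ger0_real/exprn_ge0.
by field.
Qed.

Lemma dot_CauchySchwarz x y : `|dot x y| ^+ 2 <= dot x x * dot y y.
Proof.
have [->|y0] := eqVneq y 0; first by rewrite !linear0r normr0 expr0n.
rewrite -ler_pdivrMr ?dnorm_gt0 // -subr_ge0 -dnorm_sub_proj //.
Qed.

(** Polarization: the defect of symmetry [t] is sesquilinear and vanishes on the diagonal. Expanding
    it at [x + y] and at ['i *: x + y] gives [t x y = - t y x] and [t x y = t y x]. *)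
Lemma nonneg_selfadjoint (Q : E -> E) : linear Q ->
  (forall x, 0 <= dot (Q x) x) -> forall x y, dot (Q x) y = dot x (Q y).
Proof.
move=> linQ Q0 x y; pose t x y := dot (Q x) y - dot x (Q y).
have txx z : t z z = 0.
  rewrite /t [dot z _]dotC (CrealP _) ?subrr //; exact: ger0_real.
have tE a u v : t (a *: u + v) (a *: u + v) = a * t u v + a^* * t v u.
  have -> : t (a *: u + v) (a *: u + v) =
      a * a^* * t u u + t v v + (a * t u v + a^* * t v u).
    rewrite /t !linQ !linearDl !linearDr /= !linearZl_LR !linearZr_LR /=.
    by rewrite /GRing.scale /=; ring.
  by rewrite !txx mulr0 !add0r.
have t1 := tE 1 x y; have ti := tE 'i x y.
rewrite txx conjC1 !mul1r in t1; rewrite txx conjCi mulNr -mulrBr in ti.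
move/esym/eqP: ti; rewrite mulf_eq0 (negPf (neq0Ci _)) /= subr_eq0 => /eqP txy.
move: t1; rewrite -txy => /esym/eqP.
by rewrite -mulr2n mulrn_eq0 /= subr_eq0 => /eqP.
Qed.

End InnerProduct.

(** * Subspaces and maps linear on them *)

Section Subspaces.
Variables (K : numFieldType) (E F : lmodType K).

Lemma subspace_sum (W : set E) n (c : 'I_n -> K) (v : 'I_n -> E) :
  subspace W -> (forall i, W (v i)) -> W (\sum_i c i *: v i).
Proof.
by move=> [W0 WD] Wv; elim/big_ind: _ => // [x y Wx Wy|i _];
  [rewrite -[x]scale1r | rewrite -[_ *: _]addr0]; apply: WD.
Qed.

Lemma linear_on0 (W : set E) (f : E -> F) :
  subspace W -> linear_on W f -> f 0 = 0.
Proof.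
move=> [W0 _] linf; have := linf (-1) 0 0 W0 W0.
by rewrite scaler0 addr0 scaleN1r addNr.
Qed.

Lemma linear_on_sum (W : set E) (f : E -> F) n (c : 'I_n -> K) (v : 'I_n -> E) :
  subspace W -> linear_on W f -> (forall i, W (v i)) ->
  f (\sum_i c i *: v i) = \sum_i c i *: f (v i).
Proof.
move=> sW linf; elim: n c v => [|n IH] c v Wv.
  by rewrite !big_ord0 (linear_on0 sW linf).
rewrite !big_ord_recl linf // ?IH //.
exact: subspace_sum.
Qed.

Lemma has_dim_subspace (W : set E) n : has_dim W n -> subspace W.
Proof.
case=> b [_ ->]; split.
  by exists (fun=> 0) => //; rewrite big1 // => i _; rewrite scale0r.
move=> a _ _ [c _ <-] [d _ <-]; exists (fun i => a * c i + d i) => //.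
rewrite scaler_sumr -big_split; apply: eq_bigr => i _ /=.
by rewrite scalerDl scalerA.
Qed.

End Subspaces.

(** * Quadratic forms of matrices *)

Section CoordinateForms.
Variable K : numClosedFieldType.

Lemma adjmxM m n p (A : 'M[K]_(m, n)) (B : 'M[K]_(n, p)) :
  adjmx (A *m B) = adjmx B *m adjmx A.
Proof. by rewrite /adjmx trmx_mul map_mxM. Qed.

Lemma adjmxK m n (A : 'M[K]_(m, n)) : adjmx (adjmx A) = A.
Proof. by apply/matrixP=> i j; rewrite !mxE conjCK. Qed.

Lemma adjmx_inv n (A : 'M[K]_n) : adjmx (invmx A) = invmx (adjmx A).
Proof. by rewrite /adjmx trmx_inv map_invmx. Qed.

Lemma cvdotC n (x y : 'cV[K]_n) : cvdot x y = (cvdot y x)^*.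
Proof. by rewrite /cvdot -{1}[y]adjmxK -adjmxM mxE mxE. Qed.

Lemma cvdot_mul n (M : 'M[K]_n) (x y : 'cV[K]_n) :
  cvdot x (M *m y) = cvdot (adjmx M *m x) y.
Proof. by rewrite /cvdot adjmxM adjmxK mulmxA. Qed.

Lemma cvdot_mxIm n (M : 'M[K]_n) (x : 'cV[K]_n) :
  cvdot x (mxIm M *m x) = 'Im (cvdot x (M *m x)).
Proof.
rewrite ImE -cvdotC -[in X in X - _](adjmxK M) -cvdot_mul.
rewrite /mxIm -scalemxAl mulmxBl /cvdot -scalemxAr mulmxBr !mxE.
by field: (@sqrCi K); rewrite neq0Ci.
Qed.

(** As [dot] is linear in its first argument, the entry [dot (v s) (v r)] is
    [inner dot (v r) (v s)]: the antilinear slot carries the row index. *)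
Lemma cvdot_gram (E : lmodType K) (dot : {dot E for Num.conj}) n
    (v : 'I_n -> E) (x : 'cV[K]_n) :
  cvdot x ((\matrix_(r, s) dot (v s) (v r)) *m x) =
  dot (\sum_i x i ord0 *: v i) (\sum_i x i ord0 *: v i).
Proof.
rewrite /cvdot linear_sumr mxE; apply: eq_bigr => r _.
rewrite !mxE linearZr_LR linear_sumlz /=; congr (_ * _).
by apply: eq_bigr => s _; rewrite mxE linearZl_LR mulrC.
Qed.

End CoordinateForms.

(** * Orthogonal projection onto a closed subspace *)

Section Projection.
Variables (R : realType) (H : completeNormedModType R[i]).
Variables (dot : {dot H for Num.conj}) (hdot : induces_norm dot).

(** A positive element of [R[i]] is real, so the Archimedean property of [R] applies. *)
Lemma near_natSinv_ltC (e : R[i]) : 0 < e ->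
  \forall n \near \oo, n.+1%:R^-1 < e.
Proof.
move=> e0; have re := RRe_real (gtr0_real e0).
have re0 : 0 < complex.Re e by rewrite -ltcR re.
have := near_infty_natSinv_lt (PosNum re0).
by apply: filterS => n /=; rewrite -ltcR re fmorphV /= rmorph_nat.
Qed.

Lemma dot_le_norm x y : `|dot x y| <= `|x| * `|y|.
Proof.
rewrite -(@ler_pXn2r _ 2) ?nnegrE ?mulr_ge0 // exprMn !hdot.
exact: dot_CauchySchwarz.
Qed.

Lemma parallelogram x y : dot (x - y) (x - y) =
  2 * dot x x + 2 * dot y y - 4 * dot (2^-1 *: (x + y)) (2^-1 *: (x + y)).
Proof.
rewrite dnormZ dnormB dnormD ger0_norm ?invr_ge0 //.
by field.
Qed.

Section NearestPoint.
Variables (W : set H) (z : H).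
Hypotheses (subW : subspace W) (closedW : closed W).

(** Squared distances live in the partially ordered [R[i]]; their infimum [d] is therefore taken
    over real parts. *)
Let m k := dot (z - k) (z - k).
Let d := inf [set complex.Re (m k) | k in W].

Let mR k : (complex.Re (m k))%:C%C = m k.
Proof. exact/RRe_real/ger0_real/dnorm_ge0. Qed.

Let WB k k' : W k -> W k' -> W (2^-1 *: (k + k')).
Proof.
move=> Wk Wk'; case: subW => W0 WD; rewrite -[_ *: _]addr0; apply: (WD) => //.
by rewrite -[k]scale1r; apply: (WD).
Qed.

Let d_le k : W k -> d%:C%C <= m k.
Proof.
move=> Wk; rewrite -[leRHS]mR lecR.
apply: ge_inf; last by exists k.
by exists 0 => _ [k' _ <-]; rewrite -lecR mR dnorm_ge0.
Qed.

(** The tolerance is squared so that the resulting bounds on norms are linear in [n.+1%:R^-1]. *)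
Let minimizing_seq : exists k : nat -> H,
  forall n, W (k n) /\ m (k n) <= d%:C%C + n.+1%:R^-1 ^+ 2.
Proof.
suff /boolp.choice[k kP] :
    forall n, exists x, W x /\ m x <= d%:C%C + n.+1%:R^-1 ^+ 2 by exists k.
move=> n.
have infE : has_inf [set complex.Re (m k) | k in W].
  split; first by exists (complex.Re (m 0)), 0 => //; case: subW.
  by exists 0 => _ [k' _ <-]; rewrite -lecR mR dnorm_ge0.
have e0 : 0 < n.+1%:R^-1 ^+ 2 :> R by rewrite exprn_gt0.
have [_ [k Wk <-] lek] := inf_adherent e0 infE.
exists k; split => //; rewrite -[leLHS]mR.
have -> : n.+1%:R^-1 ^+ 2 = (n.+1%:R^-1 ^+ 2)%:C%C :> R[i].
  by rewrite rmorphXn fmorphV /= rmorph_nat.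
by rewrite -rmorphD lecR ltW.
Qed.

(** Moving [k] inside [W] along [w] to the best point lowers [m k] by the squared modulus of
    [dot (z - k) w] over [dot w w], and the result is still at least [d]. *)
Let almost_orthogonal k w : W k -> W w ->
  `|dot (z - k) w| ^+ 2 <= (m k - d%:C%C) * dot w w.
Proof.
move=> Wk Ww; have [->|w0] := eqVneq w 0.
  by rewrite !linear0r normr0 expr0n.
rewrite -ler_pdivrMr ?dnorm_gt0 // -subr_ge0 addrAC subr_ge0.
rewrite -dnorm_sub_proj // -addrA -opprD.
by apply: d_le; rewrite addrC; case: subW => _; apply.
Qed.

(** Parallelogram law for [z - k j] and [z - k i]: the midpoint of [k i] and [k j] lies in [W], so
    its squared distance to [z] is at least [d]. *)
Let minimizing_cauchy (k : nat -> H) :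
    (forall n, W (k n) /\ m (k n) <= d%:C%C + n.+1%:R^-1 ^+ 2) ->
  forall i j, `|k i - k j| <= 2 * (i.+1%:R^-1 + j.+1%:R^-1).
Proof.
move=> kP i j; have [[Wi mi] [Wj mj]] := (kP i, kP j).
set a := i.+1%:R^-1 in mi *; set b := j.+1%:R^-1 in mj *.
have a0 : 0 <= a by rewrite invr_ge0.
have b0 : 0 <= b by rewrite invr_ge0.
rewrite -(@ler_pXn2r _ 2) ?nnegrE ?mulr_ge0 ?addr_ge0 // hdot.
have -> : k i - k j = (z - k j) - (z - k i).
  by rewrite opprB [RHS]addrC addrA subrK.
have mid : 2^-1 *: ((z - k j) + (z - k i)) = z - 2^-1 *: (k i + k j).
  rewrite addrACA -opprD scalerBr -mulr2n -[z *+ 2]scaler_nat scalerA mulVf //.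
  by rewrite scale1r [k j + _]addrC.
rewrite parallelogram mid -!/(m _).
have := d_le (WB Wi Wj); set mm := m (2^-1 *: _) => dm.
have -> : 2 * m (k j) + 2 * m (k i) - 4 * mm =
  2 * (m (k j) - d%:C%C) + 2 * (m (k i) - d%:C%C) - 4 * (mm - d%:C%C) by ring.
have -> : (2 * (a + b)) ^+ 2 = 2 * b ^+ 2 + 2 * a ^+ 2 +
  (2 * b ^+ 2 + 2 * a ^+ 2 + 8 * (a * b)) by ring.
apply: lerD; first by apply: lerD; rewrite ler_pM2l // lerBlDl.
apply: (@le_trans _ _ 0); first by rewrite oppr_le0 mulr_ge0 // subr_ge0.
by rewrite !addr_ge0 ?mulr_ge0 ?exprn_ge0.
Qed.

Lemma closed_subspace_projection :
  exists p, W p /\ forall w, W w -> dot (z - p) w = 0.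
Proof.
have [k kP] := minimizing_seq; have kC := minimizing_cauchy kP.
have /cauchy_cvgP kcvg : cauchy (k @ \oo).
  apply/cauchy_ballP => e e0; near_simpl.
  have e4 : 0 < e / 4 by rewrite divr_gt0.
  have [N _ NP] := near_natSinv_ltC e4.
  exists ([set n | N <= n], [set n | N <= n])%N; first by split; exists N.
  move=> [i j] [/= /NP /= Ni /NP /= Nj]; rewrite -ball_normE /=.
  apply: (le_lt_trans (kC i j)).
  have -> : e = 2 * (e / 4 + e / 4) by field.
  by rewrite ltr_pM2l // ltrD.
move/cvg_ex: kcvg => [p kp]; exists p; split.
  by apply: (closed_cvg _ closedW _ _ kp); near=> n; case: (kP n).
move=> w Ww; apply/eqP; apply: contraT => c0.
have w0 : 0 < `|w|.
  by rewrite normr_gt0; apply: contraNneq c0 => ->; rewrite linear0r.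
(* With this threshold, [z - k n] and [p - k n] each contribute less than half of the modulus of
   [dot (z - p) w], a contradiction. *)
have e0 : 0 < `|dot (z - p) w| / (2 * `|w|).
  by rewrite divr_gt0 ?normr_gt0 // mulr_gt0.
have /filter_ex [n [ne np]] : \forall n \near \oo,
    n.+1%:R^-1 < `|dot (z - p) w| / (2 * `|w|) /\
    `|p - k n| < `|dot (z - p) w| / (2 * `|w|).
  apply: filterI; first exact: near_natSinv_ltC.
  by move/cvgrPdist_lt: kp; apply.
have [Wn mn] := kP n.
have c1 : `|dot (z - k n) w| <= n.+1%:R^-1 * `|w|.
  rewrite -(@ler_pXn2r _ 2) ?nnegrE ?mulr_ge0 ?invr_ge0 // exprMn hdot.
  apply: (le_trans (almost_orthogonal Wn Ww)).
  by rewrite ler_wpM2r ?dnorm_ge0 // lerBlDl.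
have : `|dot (z - p) w| < `|dot (z - p) w|.
  have {1}-> : z - p = (z - k n) - (p - k n).
    by rewrite opprB addrA subrK.
  rewrite linearBl; apply: (le_lt_trans (ler_normB _ _)).
  apply: (le_lt_trans (lerD c1 (dot_le_norm _ _))); rewrite -mulrDl.
  rewrite -ltr_pdivlMr //.
  have -> : `|dot (z - p) w| / `|w| =
      `|dot (z - p) w| / (2 * `|w|) + `|dot (z - p) w| / (2 * `|w|).
    by field; rewrite gt_eqF.
  exact: ltrD.
by rewrite ltxx.
Unshelve. all: by end_near. Qed.

End NearestPoint.
End Projection.

(** * The inverse square root of [V] *)

Section InverseSquareRoot.
Variables (R : realType) (H : completeNormedModType R[i]).
Variables (dot : {dot H for Num.conj}) (hdot : induces_norm dot).

Lemma linear_map0 (E F : lmodType R[i]) (f : E -> F) : linear f -> f 0 = 0.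
Proof.
by move=> linf; have := linf (-1) 0 0; rewrite scaler0 addr0 scaleN1r addNr.
Qed.

Lemma linear_mapB (E F : lmodType R[i]) (f : E -> F) x y :
  linear f -> f (x - y) = f x - f y.
Proof.
by move=> linf; rewrite addrC -scaleN1r linf scaleN1r addrC.
Qed.

Lemma ker_subspace (f : H -> H) : linear f -> subspace [set x | f x = 0].
Proof.
move=> linf; split; first exact: linear_map0.
by move=> a x y /= fx fy; rewrite linf fx fy scaler0 addr0.
Qed.

Lemma closed_ker (f : H -> H) : bounded_operator f -> closed [set x | f x = 0].
Proof.
(* [M] may be zero, and need not even be real if [H] is trivial; [B] is a positive bound. *)
move=> [linf [M fM]]; pose B : R[i] := `|M| + 1.
have B0 : 0 < B by rewrite ltr_wpDl.
have fB x : `|f x| <= B * `|x|.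
  have [->|x0] := eqVneq x 0.
    by rewrite linear_map0 // !normr0 mulr0.
  rewrite -ler_pdivrMr ?normr_gt0 //.
  have MM : `|f x| / `|x| <= M by rewrite ler_pdivrMr ?normr_gt0.
  apply: (le_trans MM); rewrite ler_wpDr //; apply: real_ler_norm.
  by apply: ger0_real; apply: le_trans MM; rewrite divr_ge0.
have cf : continuous f.
  move=> x; apply/cvgrPdist_lt => e e0; near=> y.
  rewrite -linear_mapB //; apply: (le_lt_trans (fB _)).
  rewrite mulrC -ltr_pdivlMr //; near: y.
  by apply: cvgr_dist_lt => //; rewrite divr_gt0.
have c0 : closed [set 0 : H].
  by apply: accessible_closed_set1; exact: hausdorff_accessible.
by move: cf => /continuous_closedP /(_ _ c0).
Unshelve. all: by end_near. Qed.

Variable V : H -> H.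
Hypotheses (bV : bounded_operator V) (V0 : nonneg_operator dot V).

Let Q := op_sqrt dot V.

(* Also holds for the default value [V] of [op_sqrt], so that the existence of
   the square root is not needed. *)
Lemma op_sqrt_linear_ker : linear Q /\ forall x, Q x = 0 <-> V x = 0.
Proof.
rewrite /Q /op_sqrt; case: xgetP => [P _ [[linP _] P0 PP]|_]; last first.
  by case: bV.
(* Self-adjointness gives [dot (P x) (P x) = dot x (V x)], so [V x = 0] forces [P x = 0]. *)
have sP := nonneg_selfadjoint linP P0; split=> // x; split=> [Px|Vx].
  by rewrite -PP Px linear_map0.
by apply/eqP; rewrite -(dnorm_eq0 dot) sP PP Vx linear0r.
Qed.

Let linQ : linear Q := op_sqrt_linear_ker.1.

(** Subtracting from a preimage of [y] its projection onto [ker V] leaves the image unchanged, since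
    [Q] and [V] have the same kernel. *)
Lemma op_invsqrtP y : range Q y ->
  ker_perp dot V (op_invsqrt dot V y) /\ Q (op_invsqrt dot V y) = y.
Proof.
case=> z _ <-; rewrite /op_invsqrt; case: xgetP => [x _ //|none].
have [p [Vp pz]] :=
  closed_subspace_projection hdot z (ker_subspace bV.1) (closed_ker bV).
case: (none (z - p)); split; first by move=> k Vk; apply: pz.
rewrite -/Q linear_mapB // (_ : Q p = 0) ?subr0 //.
exact/op_sqrt_linear_ker.2.
Qed.

(** Two preimages in [ker_perp dot V] differ by a vector of [ker V] orthogonal to itself. *)
Lemma op_invsqrt_unique x : ker_perp dot V x -> op_invsqrt dot V (Q x) = x.
Proof.
move=> Vx; have [Vy Qy] := op_invsqrtP (imageT Q x).
apply/eqP; rewrite -subr_eq0 -(dnorm_eq0 dot) linearBl /=.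
set y := op_invsqrt dot V (Q x) in Vy Qy *.
have Vyx : V (y - x) = 0.
  by apply/op_sqrt_linear_ker.2; rewrite -/Q linear_mapB // Qy subrr.
by have := (Vy _ Vyx, Vx _ Vyx); rewrite /inner => -[-> ->]; rewrite subrr.
Qed.

Lemma op_invsqrt_linear_on : linear_on (range Q) (op_invsqrt dot V).
Proof.
move=> a x y /op_invsqrtP [Vx Qx] /op_invsqrtP [Vy Qy].
rewrite -{1}Qx -{1}Qy -linQ op_invsqrt_unique // => k Vk.
rewrite /inner linearDl linearZl_LR /= [dot _ k]Vx // [dot _ k]Vy //.
by rewrite mulr0 addr0.
Qed.

End InverseSquareRoot.

(** * The dissipativity criterion in boundary coordinates *)

Theorem theorem2p8 (R : realType) (H : completeNormedModType R[i])
    (dot : {dot H for Num.conj}) (hdot : induces_norm dot)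
    (S : operator H) (hS : symmetric_operator dot S)
    (eta : nat) (heta : defect_indices_eq dot S eta)
    (G0 G1 : H -> 'cV[R[i]]_eta) (hG : boundary_triple dot S G0 G1)
    (V : H -> H) (hV : bounded_operator V) (hV0 : nonneg_operator dot V)
    (B C : 'M[R[i]]_eta) (hB : B \in unitmx) (hC : C \in unitmx)
    (U : set H) (hUD : U `<=` op_dom (adjoint dot S)) (hU : has_dim U eta)
    (hUS : U `&` op_dom S = [set 0])
    (hSU : [set f + u | f in op_dom S & u in U] =
           [set f | op_dom (adjoint dot S) f /\ B *m G0 f = C *m G1 f])
    (L : H -> H) (hL : linear_on U L)
    (hLV : forall w, U w -> range (op_sqrt dot V) (L w))
    (u : 'I_eta -> H) (hu : forall j, U (u j))
    (huG : forall j, G1 (u j) = delta_mx j ord0) :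
  (forall w, U w ->
     'Im (inner dot w (adjoint dot S w)) >=
       4%:R^-1 * `|op_invsqrt dot V (L w)| ^+ 2)
  <->
  form_le
    (4%:R^-1 *: \matrix_(r, s) inner dot (op_invsqrt dot V (L (u r)))
                                         (op_invsqrt dot V (L (u s))))
    (mxIm (adjmx C *m invmx (adjmx B))).
Proof.
case: hG => -[_ linG1] _ green domS.
have subU := has_dim_subspace hU.
have linG1U : linear_on U G1 by move=> a x y /hUD Ux /hUD Uy; apply: linG1.
have linVL : linear_on U (fun w => op_invsqrt dot V (L w)).
  move=> a x y Ux Uy; rewrite hL //.
  by apply: op_invsqrt_linear_on => //; apply: hLV.
(* Writing [w] as [0 + w] places it in the extended domain, where the boundary condition holds. *)
have G0E w : U w -> G0 w = invmx B *m (C *m G1 w).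
  move=> Uw; have S0 : op_dom S 0 by case: hS => -[].
  have : [set f + u | f in op_dom S & u in U] w.
    by exists 0 => //; exists w => //; rewrite add0r.
  by rewrite hSU => -[_ <-]; rewrite mulKmx.
have G1sum (x : 'cV[R[i]]_eta) : G1 (\sum_j x j ord0 *: u j) = x.
  rewrite (linear_on_sum _ subU linG1U) // [RHS]matrix_sum_delta.
  by apply: eq_bigr => j _; rewrite big_ord1 huG.
have Usum (x : 'cV[R[i]]_eta) : U (\sum_j x j ord0 *: u j).
  exact: subspace_sum.
(* The difference lies in [U] and is killed by [G1], hence by [G0] through [G0E]; so it lies in both
   [U] and the domain of [S]. *)
have wE w : U w -> w = \sum_j G1 w j ord0 *: u j.
  move=> Uw; set v := \sum_j _; have Uv : U v := Usum _.
  have Uwv : U (w - v) by rewrite addrC -scaleN1r; apply: subU.2.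
  have G1wv : G1 (w - v) = 0.
    by rewrite addrC -scaleN1r linG1U // G1sum scaleN1r addNr.
  have : [set 0] (w - v).
    rewrite -hUS domS; split => //; split => //; first exact: hUD.
    by rewrite G0E // G1wv !mulmx0.
  by move/eqP; rewrite subr_eq0 => /eqP.
set N := adjmx C *m invmx (adjmx B).
have adjN : adjmx N = invmx B *m C.
  by rewrite /N adjmxM adjmxK adjmx_inv adjmxK.
have dissE w : U w ->
    'Im (inner dot w (adjoint dot S w)) = cvdot (G1 w) (mxIm N *m G1 w).
  move=> Uw; have := green w w (hUD _ Uw) (hUD _ Uw).
  (* Moving [N] to the left slot turns [G1 w] into [G0 w]. [ImE] puts the conjugate first, opposite
     to Green's identity, hence the two uses of [opprB]. *)
  rewrite cvdot_mxIm cvdot_mul adjN -mulmxA -G0E // !ImE.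
  rewrite /inner -!dotC -!cvdotC => E.
  by rewrite -opprB E opprB.
have normE w : U w -> 4%:R^-1 * `|op_invsqrt dot V (L w)| ^+ 2 =
    cvdot (G1 w) ((4%:R^-1 *: \matrix_(r, s) inner dot
      (op_invsqrt dot V (L (u r))) (op_invsqrt dot V (L (u s)))) *m G1 w).
  move=> Uw; rewrite -scalemxAl /cvdot -scalemxAr mxE; congr (_ * _).
  rewrite -[RHS]/(cvdot _ _) cvdot_gram hdot.
  by rewrite {1 2}(wE w Uw) (linear_on_sum _ subU linVL).
split=> [dis x|form w Uw]; last first.
  by rewrite (normE _ Uw) (dissE _ Uw); apply: form.
(* Every [x] is [G1] of a vector of [U], at which the dissipativity condition is evaluated. *)
rewrite -(G1sum x) -(normE _ (Usum x)) -(dissE _ (Usum x)).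
exact: dis (Usum x).
Qed.
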